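(* Let $G$ be a singleton-partition graph of order $n$ with $\delta(G)=0$. Then: (a) If $n=1$, then $G=K_1$, $L_{\rm SCC}(G)=0$, and the $G$-SC chain is $K_1\to K_1\to K_1\to\cdots$. (b) If $n=2$, then $G=\overline{K}_2$, $L_{\rm SCC}(G)=\infty$, and the $G$-SC chain is $\overline{K}_2\to K_2\to\overline{K}_2\to K_2\to\cdots$. (c) If $n>3$, then $G\cong K_1\cup K_{n-1}$, $L_{\rm SCC}(G)=1$, and the $G$-SC chain is $G\to K_{1,n-1}$. (d) If $n=3$, then $G=K_1\cup K_2$, $L_{\rm SCC}(G)=\infty$, and the $G$-SC chain is $K_1\cup K_2\to P_3\to K_1\cup K_2\to P_3\to\cdots$.
   Context: All graphs are finite and simple. A full vertex is a vertex adjacent to all other vertices. A set $D\subseteq V$ is dominating if every vertex not in $D$ has a neighbor in $D$. Two disjoint sets $A,B\subseteq V$ form a coalition if neither is dominating but $A\cup B$ is. A coalition partition of $G$ is a partition $\mathcal{P}$ of $V$ such that every member is either a dominating set of cardinality 1, or is not dominating and forms a coalition with some other member. The coalition graph ${\rm CG}(G,\mathcal{P})$ has vertex set $\mathcal{P}$, two members adjacent iff they form a coalition. $\Gamma_1$ is the partition of $V$ into singletons; $G$ is a singleton-partition graph (SP-graph) if $\Gamma_1$ is a coalition partition of $G$. A singleton coalition graph chain with initial graph $G_1$ is a sequence $G_1\to G_2\to\cdots$ where each graph having a successor is an SP-graph and its successor is ${\rm CG}(G_i,\Gamma_1)$ (up to isomorphism). The $G$-SC chain is such a chain starting at $G$ of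 maximum possible length (it continues as long as the current graph is an SP-graph; it is infinite if this never fails). Its length $L_{\rm SCC}(G)$ is $k-1$ for a chain $G_1\to\cdots\to G_k$ and $\infty$ for an infinite chain, with the convention that if all graphs in the chain are isomorphic the length is $0$. (E.g. $C_4\to K_4\to\overline{K}_4$ has length 2.) $\overline{K}_m$ is the edgeless graph on $m$ vertices, $\cup$ is disjoint union. *)

(* Defs.v *)
From HB Require Import structures.
From mathcomp Require Import all_boot.
From mathcomp Require Import boolp.

Set Implicit Arguments.
Unset Strict Implicit.
Unset Printing Implicit Defensive.

Record sgraph := SGraph {
  svertex :> finType;
  sedge : rel svertex;
  sedge_sym : symmetric sedge;
  sedge_irr : irreflexive sedge }.

Notation "x -- y" := (sedge x y) (at level 30).

Definition iso (G H : sgraph) : Prop :=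
  exists2 f : G -> H, bijective f & forall x y, (f x -- f y) = (x -- y).

Notation "G ≅ H" := (iso G H) (at level 70).

Definition graph_order (G : sgraph) : nat := #|G|.

Definition degree (G : sgraph) (v : G) : nat := #|[set u : G | v -- u]|.

(* Degrees are smaller than the order, so the default value [#|G|] of the
   iterated minimum is irrelevant as soon as G has a vertex. *)
Definition min_degree (G : sgraph) : nat := \big[minn/#|G|]_(v : G) degree v.

Definition complete_rel n : rel 'I_n := fun i j => i != j.
Lemma complete_sym n : symmetric (@complete_rel n).
Proof. by move=> i j; rewrite /complete_rel eq_sym. Qed.
Lemma complete_irr n : irreflexive (@complete_rel n).
Proof. by move=> i; rewrite /complete_rel eqxx. Qed.
Definition complete n := SGraph (@complete_sym n) (@complete_irr n).

Definition edgeless_rel n : rel 'I_n := fun _ _ => false.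
Lemma edgeless_sym n : symmetric (@edgeless_rel n).
Proof. by []. Qed.
Lemma edgeless_irr n : irreflexive (@edgeless_rel n).
Proof. by []. Qed.
Definition edgeless n := SGraph (@edgeless_sym n) (@edgeless_irr n).

Definition path_rel n : rel 'I_n := fun i j => (i.+1 == j) || (j.+1 == i).
Lemma path_sym n : symmetric (@path_rel n).
Proof. by move=> i j; rewrite /path_rel orbC. Qed.
Lemma path_irr n : irreflexive (@path_rel n).
Proof. by move=> i; rewrite /path_rel orbb gtn_eqF. Qed.
Definition path_graph n := SGraph (@path_sym n) (@path_irr n).

Definition bipartite_rel m n : rel ('I_m + 'I_n) := fun x y =>
  match x, y with inl _, inr _ | inr _, inl _ => true | _, _ => false end.
Lemma bipartite_sym m n : symmetric (@bipartite_rel m n).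
Proof. by move=> [i|i] [j|j]. Qed.
Lemma bipartite_irr m n : irreflexive (@bipartite_rel m n).
Proof. by move=> [i|i]. Qed.
Definition complete_bipartite m n :=
  SGraph (@bipartite_sym m n) (@bipartite_irr m n).

Definition union_rel (G H : sgraph) : rel (G + H) := fun x y =>
  match x, y with
  | inl a, inl b => a -- b
  | inr a, inr b => a -- b
  | _, _ => false
  end.
Lemma union_sym G H : symmetric (@union_rel G H).
Proof. by move=> [a|a] [b|b] //=; rewrite sedge_sym. Qed.
Lemma union_irr G H : irreflexive (@union_rel G H).
Proof. by move=> [a|a] /=; rewrite sedge_irr. Qed.
Definition disjoint_union G H := SGraph (@union_sym G H) (@union_irr G H).

Definition dominating (G : sgraph) (D : {set G}) : bool :=
  [forall v, (v \notin D) ==> [exists u in D, v -- u]].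

Definition coalition (G : sgraph) (A B : {set G}) : bool :=
  [&& [disjoint A & B], ~~ dominating A, ~~ dominating B
    & dominating (A :|: B)].

Definition coalition_partition (G : sgraph) (P : {set {set G}}) : bool :=
  partition P [set: G] &&
  [forall A in P,
     (dominating A && (#|A| == 1)) ||
     (~~ dominating A && [exists B in P, (B != A) && coalition A B])].

Definition coalition_rel (G : sgraph) (P : {set {set G}}) :
  rel {A : {set G} | A \in P} := fun A B => coalition (val A) (val B).
Lemma coalition_sym (G : sgraph) (P : {set {set G}}) :
  symmetric (@coalition_rel G P).
Proof.
move=> A B; rewrite /coalition_rel /coalition disjoint_sym setUC.
by congr (_ && _); rewrite andbCA.
Qed.
Lemma coalition_irr (G : sgraph) (P : {set {set G}}) :
  irreflexive (@coalition_rel G P).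
Proof.
move=> A; rewrite /coalition_rel /coalition setUid.
by case: (dominating _); rewrite ?andbF.
Qed.

Definition coalition_graph (G : sgraph) (P : {set {set G}}) : sgraph :=
  SGraph (@coalition_sym G P) (@coalition_irr G P).

Definition singleton_partition (G : sgraph) : {set {set G}} :=
  [set [set v] | v in G].

Definition SP_graph (G : sgraph) : bool :=
  coalition_partition (singleton_partition G).

Definition singleton_coalition_graph (G : sgraph) : sgraph :=
  coalition_graph (singleton_partition G).

Inductive enat := Fin of nat | Infty.

Definition leqe (x y : enat) : bool :=
  match x, y with
  | Fin m, Fin n => m <= n
  | _, Infty => true
  | Infty, Fin _ => false
  end.

(* [FinChain G1 [:: G2; ...; Gk]] stands for G1 -> G2 -> ... -> Gk. *)
Inductive chain :=
  | FinChain of sgraph & seq sgraph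
  | InfChain of nat -> sgraph.

(* Indices start at 0; only those [i] with [leqe (Fin i) (steps c)] are
   meaningful. *)
Definition chain_nth (c : chain) (i : nat) : sgraph :=
  match c with
  | FinChain G s => nth G (G :: s) i
  | InfChain g => g i
  end.

Definition steps (c : chain) : enat :=
  match c with FinChain _ s => Fin (size s) | InfChain _ => Infty end.

Definition singleton_coalition_chain (c : chain) : Prop :=
  forall i, leqe (Fin i.+1) (steps c) ->
    SP_graph (chain_nth c i) /\
    chain_nth c i.+1 ≅ singleton_coalition_graph (chain_nth c i).

Definition SC_chain_from (G : sgraph) (c : chain) : Prop :=
  chain_nth c 0 ≅ G /\ singleton_coalition_chain c.

(* [c] is the G-SC chain.  It is determined only up to isomorphism of its
   graphs.  Maximality refers to the number of steps, not to [chain_length],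
   whose convention for constant chains would make the chains K_1,
   K_1 -> K_1, ... all equally long. *)
Definition G_SC_chain (G : sgraph) (c : chain) : Prop :=
  SC_chain_from G c /\
  forall c', SC_chain_from G c' -> leqe (steps c') (steps c).

Definition chain_length (c : chain) : enat :=
  if `[< forall i, leqe (Fin i) (steps c) -> chain_nth c i ≅ chain_nth c 0 >]
  then Fin 0 else steps c.

Lemma iso_refl G : G ≅ G.
Proof. by exists id => //; exists id. Qed.

Lemma iso_sym G H : G ≅ H -> H ≅ G.
Proof.
move=> [f [g fK gK] fE]; exists g; first by exists f.
by move=> x y; rewrite -fE !gK.
Qed.

Lemma iso_trans G H K : G ≅ H -> H ≅ K -> G ≅ K.
Proof.
move=> [f fb fE] [g gb gE]; exists (g \o f); first exact: bij_comp.
by move=> x y; rewrite /= gE fE.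
Qed.

Lemma dominating_imset (G H : sgraph) (f : G -> H) (D : {set G}) :
  bijective f -> (forall x y, (f x -- f y) = (x -- y)) ->
  dominating (f @: D) = dominating D.
Proof.
move=> fb fE; have fi := bij_inj fb; have [g fK gK] := fb.
apply/forallP/forallP => h v; apply/implyP => vD.
  have := h (f v); rewrite mem_imset // vD /= => /exists_inP[_ /imsetP[u uD ->]].
  by rewrite fE => vu; apply/exists_inP; exists u.
have := h (g v); move: vD; rewrite -{1}(gK v) mem_imset // => -> /=.
move=> /exists_inP[u uD vu]; apply/exists_inP; exists (f u).
  by rewrite mem_imset.
by rewrite -(gK v) fE.
Qed.

Lemma coalition_imset (G H : sgraph) (f : G -> H) (A B : {set G}) :
  bijective f -> (forall x y, (f x -- f y) = (x -- y)) ->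
  coalition (f @: A) (f @: B) = coalition A B.
Proof.
move=> fb fE; have fi := bij_inj fb.
rewrite /coalition -imsetU !dominating_imset //.
congr (_ && _); rewrite -!setI_eq0 -imsetI; last by move=> x y _ _; apply: fi.
by rewrite imset_eq0.
Qed.

Lemma singleton_partitionP (G : sgraph) :
  partition (singleton_partition G) [set: G].
Proof.
apply/and3P; split.
- apply/eqP/setP=> x; rewrite inE; apply/bigcupP; exists [set x].
    exact: imset_f.
  exact: set11.
- apply/trivIsetP=> _ _ /imsetP[x _ ->] /imsetP[y _ ->] xy.
  rewrite disjoints1 in_set1; apply: contraNneq xy => ->; exact: eqxx.
- by apply/imsetP=> -[x _ /setP/(_ x)]; rewrite !inE eqxx.
Qed.

Lemma SP_graphP (G : sgraph) :
  reflect (forall v : G, dominating [set v] \/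
                         exists u, coalition [set v] [set u])
          (SP_graph G).
Proof.
rewrite /SP_graph /coalition_partition singleton_partitionP /=.
apply: (iffP forall_inP) => h.
  move=> v; have /orP[/andP[-> _]|/andP[_]] := h _ (imset_f _ (erefl _) : [set v] \in _).
    by left.
  move=> /exists_inP[_ /imsetP[u _ ->] /andP[_ c]].
  by right; exists u.
move=> _ /imsetP[v _ ->]; rewrite cards1 eqxx andbT.
case: (h v) => [->//|[u c]]; have /and4P[d nv _ _] := c.
apply/orP; right; rewrite nv; apply/exists_inP; exists [set u].
  exact: imset_f.
rewrite c andbT; apply: contraTneq d => ->.
by rewrite disjoints1 set11.
Qed.

Lemma iso_SP (G H : sgraph) : G ≅ H -> SP_graph G -> SP_graph H.
Proof.
move=> [f fb fE] /SP_graphP sp; apply/SP_graphP => v.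
have [g fK gK] := fb; rewrite -(gK v) -(imset_set1 f).
case: (sp (g v)) => [d|[u c]].
  by left; rewrite dominating_imset.
by right; exists (f u); rewrite -(imset_set1 f) coalition_imset.
Qed.

Lemma mem_singleton_partition (G : sgraph) (v : G) :
  [set v] \in singleton_partition G.
Proof. exact: imset_f. Qed.

Definition singleton_vertex (G : sgraph) (v : G) : singleton_coalition_graph G :=
  exist _ [set v] (mem_singleton_partition v).

Lemma singleton_vertex_bij (G : sgraph) : bijective (@singleton_vertex G).
Proof.
apply: inj_card_bij => [x y /(congr1 val) /set1_inj //|].
rewrite card_sig /= (eq_card (_ : _ =i singleton_partition G)) //.
by rewrite card_imset //; apply: set1_inj.
Qed.

Lemma iso_singleton_coalition_graph (G H : sgraph) : G ≅ H ->
  singleton_coalition_graph G ≅ singleton_coalition_graph H.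
Proof.
move=> [f fb fE]; have [g gK Kg] := singleton_vertex_bij G.
exists (@singleton_vertex H \o (f \o g)).
  apply: bij_comp; first exact: singleton_vertex_bij.
  by apply: bij_comp => //; exists (@singleton_vertex G).
move=> x y; rewrite -{2}(Kg x) -{2}(Kg y).
by rewrite /sedge /= /coalition_rel /= -!(imset_set1 f) coalition_imset.
Qed.

Lemma chain_nth_iter G c i : SC_chain_from G c -> leqe (Fin i) (steps c) ->
  chain_nth c i ≅ iter i singleton_coalition_graph G.
Proof.
move=> [c0 cS]; elim: i => [//|i IH] ic.
have [_ h] := cS _ ic; apply: iso_trans h _.
apply/iso_singleton_coalition_graph/IH.
by case: (steps c) ic => //= n /ltnW.
Qed.

Lemma G_SC_chain_exists G : exists c, G_SC_chain G c.
Proof.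
pose g i := iter i singleton_coalition_graph G.
case: (pselect (exists i, ~~ SP_graph (g i))) => [ex|nex]; last first.
  exists (InfChain g); split=> [|[]//].
  split=> [|i _]; first exact: iso_refl.
  split; last exact: iso_refl.
  by apply: contrapT => /negP ni; apply: nex; exists i.
case: (ex_minnP ex) => m nm min_m.
exists (FinChain G (mkseq (fun i => g i.+1) m)).
have nthE i : i <= m -> chain_nth (FinChain G (mkseq (fun i => g i.+1) m)) i = g i.
  by case: i => [//|i] im; rewrite /= nth_mkseq.
split.
  split=> [|i]; first exact: iso_refl.
  rewrite /steps /leqe size_mkseq => im.
  rewrite !nthE // ?(ltnW im) //; split; last exact: iso_refl.
  by apply: contraTT im => /min_m; rewrite leqNgt.
move=> c' c'G; rewrite [X in leqe _ X]/= size_mkseq.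
apply: contraNT nm => lt_c'.
have hm : leqe (Fin m.+1) (steps c').
  by case: (steps c') lt_c' => //= k; rewrite -ltnNge.
have [sp _] := c'G.2 _ hm; apply: iso_SP sp; apply: chain_nth_iter => //.
by case: (steps c') hm => //= n /ltnW.
Qed.

(* Any two G-SC chains have isomorphic graphs at each index, so the value does
   not depend on the chain picked. *)
Definition L_SCC (G : sgraph) : enat :=
  chain_length (projT1 (cid (G_SC_chain_exists G))).

(* Main.v *)
(* Let v be isolated in the SP-graph G.  Dominating sets contain v, so every
   other vertex has v as its only partner, which forces the vertices other than
   v to be pairwise adjacent: G = K_1 + K_{n-1}.  Its
   singleton coalition graph is the star centred at v.  In a star with at least
   four vertices no leaf has a partner, so the chain stops; with at most three
   vertices the singleton coalition graph of the star is K_1 + K_{n-1} again. *)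
Require Import Defs.
From mathcomp Require Import all_boot.
From mathcomp Require Import fingroup perm boolp.

Set Implicit Arguments.
Unset Strict Implicit.
Unset Printing Implicit Defensive.

(** * Graphs described by one distinguished vertex *)

Definition pointed_at (r : bool -> bool -> bool -> bool) (G : sgraph) (c : G) :=
  forall a b : G, (a -- b) = r (a == c) (b == c) (a == b).

(** With $m$ vertices, [isolated_clique] describes $K_1\cup K_{m-1}$ with isolated vertex [c], and
    [star] describes $K_{1,m-1}$ with centre [c]. *)
Notation isolated_clique := (pointed_at (fun p q e => ~~ [|| p, q | e])).
Notation star := (pointed_at (fun p q _ => p (+) q)).

Lemma pointed_bijection (S T : finType) (c : S) (d : T) : #|S| = #|T| ->
  exists2 f : S -> T, bijective f & f c = d.
Proof.
move=> e; pose f0 x : T := enum_val (cast_ord e (enum_rank x)).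
have f0b : bijective f0.
  apply: inj_card_bij; last by rewrite e.
  by move=> x y /enum_val_inj /cast_ord_inj /enum_rank_inj.
(* A transposition corrects the image of [c] to [d]. *)
exists (tperm (f0 c) d \o f0); last by rewrite /= tpermL.
by apply: bij_comp f0b; exists (tperm (f0 c) d); apply: tpermK.
Qed.

(** Any bijection matching the distinguished vertices preserves the three booleans fed to [r], so
    [r] and the order determine the graph. *)
Lemma pointed_iso r (G H : sgraph) (c : G) (d : H) :
  pointed_at r c -> pointed_at r d -> #|G| = #|H| -> G ≅ H.
Proof.
move=> Gr Hr /(pointed_bijection c d)[f fb fc]; exists f => // x y.
by rewrite Hr Gr -fc !(inj_eq (bij_inj fb)).
Qed.

Lemma card_iso (G H : sgraph) : G ≅ H -> #|G| = #|H|.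
Proof. by case=> f /bij_eq_card. Qed.

Lemma card_singleton_coalition_graph G : #|singleton_coalition_graph G| = #|G|.
Proof. exact/esym/(bij_eq_card (@singleton_vertex_bij G)). Qed.

(** Through the bijection sending a vertex to its singleton, adjacency in the coalition graph can be
    computed on the vertices of [G]. *)
Lemma pointed_singleton_coalition_graph r (G : sgraph) (c : G) :
  (forall a b : G, coalition [set a] [set b] = r (a == c) (b == c) (a == b)) ->
  pointed_at r (singleton_vertex c).
Proof.
move=> h a b; have [g gK Kg] := singleton_vertex_bij G.
rewrite -(Kg a) -(Kg b) !(inj_eq (bij_inj (@singleton_vertex_bij G))).
exact: h.
Qed.

(** * Domination and coalitions of singletons *)

Lemma dominating1P (G : sgraph) (x : G) :
  reflect (forall z, z != x -> z -- x) (dominating [set x]).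
Proof.
apply: (iffP forallP) => h z.
  move=> zx; have := h z; rewrite in_set1 zx => /exists_inP[u].
  by rewrite in_set1 => /eqP->.
apply/implyP; rewrite in_set1 => /h zx.
by apply/exists_inP; exists x; rewrite ?set11.
Qed.

Lemma dominating2P (G : sgraph) (x y : G) :
  reflect (forall z, z != x -> z != y -> z -- x \/ z -- y)
          (dominating ([set x] :|: [set y])).
Proof.
apply: (iffP forallP) => h z.
  move=> zx zy; have := h z; rewrite !inE negb_or zx zy => /exists_inP[u].
  by rewrite !inE => /orP[] /eqP->; [left|right].
apply/implyP; rewrite !inE negb_or => /andP[zx zy].
by case: (h z zx zy) => e; apply/exists_inP; [exists x|exists y];
  rewrite ?inE ?eqxx ?orbT.
Qed.

Lemma coalition1P (G : sgraph) (x y : G) :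
  reflect [/\ x != y, ~~ dominating [set x], ~~ dominating [set y]
            & forall z, z != x -> z != y -> z -- x \/ z -- y]
          (coalition [set x] [set y]).
Proof.
rewrite /coalition disjoints1 in_set1.
by apply: (iffP and4P) => -[? ? ? /dominating2P ?]; split.
Qed.

Lemma SP_isolated_clique (G : sgraph) (v : G) :
  SP_graph G -> degree v = 0 -> isolated_clique v.
Proof.
move=> /SP_graphP sp /eqP; rewrite cards_eq0 => /eqP/setP deg0.
have iso_v u : (v -- u) = false by have := deg0 u; rewrite !inE.
move=> a b; have [->|av] /= := eqVneq a v; first exact: iso_v.
have [->|bv] /= := eqVneq b v; first by rewrite sedge_sym.
have [->|ab] /= := eqVneq a b; first exact: sedge_irr.
have vb : v != b by rewrite eq_sym.
case: (sp b) => [/dominating1P/(_ v vb)|[u /coalition1P[_ _ _ dom]]].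
  by rewrite iso_v.
(* The partner of [b] must be [v], since otherwise nothing dominates [v]; then [a], not adjacent to
   [v], must be adjacent to [b]. *)
have [uv|uv] := eqVneq u v; last first.
  by case: (dom v vb); rewrite ?iso_v // eq_sym.
by rewrite uv in dom; case: (dom a ab av) => //; rewrite sedge_sym iso_v.
Qed.

(** * Coalitions in an isolated vertex plus a clique *)

Section IsolatedClique.
Variables (G : sgraph) (c : G).
Hypothesis Gc : isolated_clique c.

(** Only [c] dominates [c], so a coalition contains it; any other vertex then dominates the
    clique. *)
Lemma isolated_clique_coalition (a b : G) :
  coalition [set a] [set b] = (a == c) (+) (b == c).
Proof.
(* By symmetry, if exactly one of the two vertices is [c], it may be taken to be [a]. *)
wlog bc : a b / (b == c) ==> (a == c).
  move=> h; case: (boolP ((b == c) ==> (a == c))) => [|bc]; first exact: h.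
  rewrite addbC -h; last by move: bc; case: (a == c); case: (b == c).
  exact: (coalition_sym (singleton_vertex a) (singleton_vertex b)).
apply/coalition1P/idP => [[ab _ _ dom]|].
  have [ac|ac] := eqVneq a c; first by rewrite -ac eq_sym.
  move: bc; rewrite (negPf ac) implybF => bc.
  by case: (dom c); rewrite 1?eq_sym // !Gc eqxx.
have [->|ac] := eqVneq a c; last first.
  by move: bc; rewrite (negPf ac) implybF addFb => /negPf->.
rewrite addTb => bc'; split.
- by rewrite eq_sym.
- by apply/negP => /dominating1P/(_ b bc'); rewrite Gc eqxx orbT.
- by apply/negP => /dominating1P/(_ c); rewrite eq_sym bc' Gc eqxx => /(_ isT).
- by move=> z zc zb; right; rewrite Gc (negPf zc) (negPf zb) (negPf bc').
Qed.

Lemma isolated_clique_SP : SP_graph G.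
Proof.
apply/SP_graphP => v; have [->|vc] := eqVneq v c; last first.
  by right; exists c; rewrite isolated_clique_coalition eqxx (negPf vc).
case: (pickP (predC1 c)) => [u /= uc|h].
  by right; exists u; rewrite isolated_clique_coalition eqxx (negPf uc).
(* Here [c] is the only vertex, hence dominating. *)
by left; apply/dominating1P => z zc; have := h z; rewrite /= zc.
Qed.

Lemma isolated_clique_step : star (singleton_vertex c).
Proof. exact/pointed_singleton_coalition_graph/isolated_clique_coalition. Qed.

End IsolatedClique.

(** * Coalitions in a star *)

Section Star.
Variables (G : sgraph) (c : G).
Hypothesis Gc : star c.

Lemma star_center_dominating : dominating [set c].
Proof. by apply/dominating1P => z zc; rewrite Gc eqxx (negPf zc). Qed.

(** The centre dominates alone, so it joins no coalition; two leaves dominate the centre but no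
    third leaf. *)
Lemma coalition_starP (a b : G) :
  reflect [/\ a != c, b != c, a != b &
              forall z, z != c -> z != a -> z = b]
          (coalition [set a] [set b]).
Proof.
apply: (iffP (coalition1P a b)) => [[ab da db dom]|[ac bc ab h]].
  have nc x : ~~ dominating [set x] -> x != c.
    by apply: contraNneq => ->; apply: star_center_dominating.
  split=> //; [exact: nc|exact: nc|move=> z zc za].
  apply/eqP; case: (eqVneq z b) => // zb.
  by case: (dom z za zb); rewrite Gc ?(negPf zc) ?(negPf (nc _ da)) ?(negPf (nc _ db)).
split=> //.
- apply/negP => /dominating1P/(_ b); rewrite eq_sym ab Gc (negPf ac) (negPf bc).
  by move=> /(_ isT).
- by apply/negP => /dominating1P/(_ a ab); rewrite Gc (negPf ac) (negPf bc).
- move=> z za zb; left; rewrite Gc (negPf ac) addbF.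
  by apply: contraNT zb => /h->.
Qed.

(** Turns the existence of a third leaf into a bound on the order. *)
Lemma card_gt3P (a b : G) : a != c -> b != c -> a != b ->
  (exists z, [/\ z != c, z != a & z != b]) <-> 3 < #|G|.
Proof.
move=> ac bc ab; have c3 : #|[set c; a; b]| = 3.
  by rewrite setUC cardsU1 cards2 !inE negb_or bc (eq_sym b) ab eq_sym ac.
split=> [[z [zc za zb]]|].
  rewrite -c3 -cardsT proper_card // properEneq subsetT andbT.
  apply/eqP => /setP/(_ z); rewrite !inE (negPf zc) (negPf za) (negPf zb).
  by [].
rewrite -c3 -cardsT => h.
have /properP[_ [z _]] : [set c; a; b] \proper [set: G].
  by rewrite properEcard subsetT.
by rewrite !inE !negb_or -andbA => /and3P[zc za zb]; exists z.
Qed.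

Lemma star_coalition (a b : G) : #|G| <= 3 ->
  coalition [set a] [set b] = ~~ [|| a == c, b == c | a == b].
Proof.
move=> le3; rewrite !negb_or.
apply/coalition_starP/and3P => [[]//|[ac bc ab]]; split=> // z zc za.
apply/eqP; case: (eqVneq z b) => // zb; move: le3; rewrite leqNgt.
by case/negP; apply/(card_gt3P ac bc ab); exists z.
Qed.

Lemma star_SP : SP_graph G = (#|G| <= 3).
Proof.
apply/SP_graphP/idP => [sp|le3 v].
  rewrite leqNgt; apply/negP => gt3.
  (* A leaf [v] that is not dominating needs a leaf [w] as partner, and a third leaf contradicts
     this. *)
  have gt2 : 1 < #|[set~ c]| by rewrite cardsC1; case: #|G| gt3 => [|[|[]]].
  have /card_gt1P[v [u []]] := gt2; rewrite !inE => vc uc vu.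
  case: (sp v) => [/dominating1P/(_ u)|[w /coalition_starP[_ wc vw h]]].
    by rewrite eq_sym vu Gc (negPf vc) (negPf uc) => /(_ isT).
  have [z [zc zv]] := (card_gt3P vc wc vw).2 gt3.
  by rewrite (h z) ?eqxx.
have [->|vc] := eqVneq v c; first by left; apply: star_center_dominating.
case: (pickP [pred u | (u != c) && (v != u)]) => [u /= /andP[uc vu]|h].
  by right; exists u; rewrite star_coalition // !negb_or vc uc.
(* Without a second leaf, [v] has only the centre to dominate. *)
left; apply/dominating1P => z zv; have := h z; rewrite /= (eq_sym v) zv andbT.
by move=> /negbFE/eqP->; rewrite Gc eqxx (negPf vc).
Qed.

Lemma star_step : #|G| <= 3 -> isolated_clique (singleton_vertex c).
Proof.
move=> le3; apply: pointed_singleton_coalition_graph => a b.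
exact: star_coalition.
Qed.

End Star.

Lemma star_nbr (G : sgraph) (c u : G) : star c -> 1 < #|G| -> exists w, u -- w.
Proof.
move=> Gc gt1; have [->|uc] := eqVneq u c; last first.
  by exists c; rewrite Gc eqxx (negPf uc).
have : 0 < #|[set~ c]| by rewrite cardsC1 -subn1 subn_gt0.
by case/card_gt0P => x; rewrite !inE => xc; exists x; rewrite Gc eqxx (negPf xc).
Qed.

(** A star with an edge has no isolated vertex. At order 1 both shapes are $K_1$, hence the
    bound. *)
Lemma isolated_clique_star_niso (G H : sgraph) (c : G) (d : H) :
  isolated_clique c -> star d -> 1 < #|G| -> ~ H ≅ G.
Proof.
move=> Gc Hd + HG; rewrite -(card_iso HG); have [f [g fK gK] fE] := HG.
by move=> /(star_nbr (g c) Hd)[w]; rewrite -fE gK Gc eqxx.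
Qed.

(** * The named graphs as isolated cliques or stars *)

Lemma complete_bipartite_star m :
  @star (complete_bipartite 1 m) (inl ord0).
Proof. by move=> [a|a] [b|b]; rewrite ?ord1 ?eqxx. Qed.

Lemma disjoint_union_isolated_clique m :
  @isolated_clique (disjoint_union (complete 1) (complete m)) (inl ord0).
Proof. by move=> [a|a] [b|b]; rewrite ?(ord1 a) ?(ord1 b) ?eqxx. Qed.

Lemma complete1_isolated_clique : @isolated_clique (complete 1) ord0.
Proof. by move=> a b; rewrite !ord1. Qed.

Lemma edgeless2_isolated_clique : @isolated_clique (edgeless 2) ord0.
Proof. by do 2!case=> [[|[|[]]] ?] //. Qed.

Lemma complete2_star : @star (complete 2) ord0.
Proof. by do 2!case=> [[|[|[]]] ?] //. Qed.

Lemma path3_star : @star (path_graph 3) (@Ordinal 3 1 isT).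
Proof. by do 2!case=> [[|[|[|[]]]] ?] //. Qed.

(** * Chains and their lengths *)

Lemma leqe_anti x y : leqe x y -> leqe y x -> x = y.
Proof.
by case: x y => [m|] [n|] //= mn nm; congr Fin; apply/eqP; rewrite eqn_leq mn.
Qed.

(** Maximality gives two such chains equally many steps, and at each index both are isomorphic to
    the same iterate, so the constancy test agrees. *)
Lemma L_SCC_chain (G : sgraph) (c : chain) :
  G_SC_chain G c -> L_SCC G = chain_length c.
Proof.
rewrite /L_SCC; case: (cid _) => c' /= [c'G c'max] [cG cmax].
have eqs : steps c' = steps c by apply: leqe_anti; [apply: cmax|apply: c'max].
rewrite /chain_length eqs; congr (if _ then _ else _).
have same i : leqe (Fin i) (steps c) -> chain_nth c' i ≅ chain_nth c i.
  move=> ic; apply: iso_trans (chain_nth_iter c'G _) _; first by rewrite eqs.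
  exact/iso_sym/chain_nth_iter.
have le0 : leqe (Fin 0) (steps c) by case: (steps c).
apply/asboolP/asboolP => h i ic.
  apply: iso_trans (iso_sym (same i ic)) _.
  exact: iso_trans (h i ic) (same 0 le0).
apply: iso_trans (same i ic) _.
exact: iso_trans (h i ic) (iso_sym (same 0 le0)).
Qed.

Lemma G_SC_chain_infinite (G : sgraph) (g : nat -> sgraph) :
  g 0 ≅ G -> (forall i, SP_graph (g i)) ->
  (forall i, g i.+1 ≅ singleton_coalition_graph (g i)) ->
  G_SC_chain G (InfChain g).
Proof. by move=> g0 sp st; split=> [|c' _]; [split|case: (steps c')]. Qed.

(** Common core of orders 2 and 3: both shapes are SP-graphs and the coalition graph exchanges them.
    They are not isomorphic, so the convention for constant chains does not apply. *)
Lemma alternating_chain (G H K : sgraph) (c : H) (d : K) :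
  isolated_clique c -> star d -> #|H| = #|K| -> 1 < #|H| <= 3 -> G ≅ H ->
  L_SCC G = Infty /\ G_SC_chain G (InfChain (fun i => if odd i then K else H)).
Proof.
move=> Hc Kd eqHK /andP[gt1 le3] GH.
have chG : G_SC_chain G (InfChain (fun i => if odd i then K else H)).
  apply: G_SC_chain_infinite => [|i|i]; first exact: iso_sym.
    by case: ifP => _; [rewrite (star_SP Kd) -eqHK|apply: isolated_clique_SP Hc].
  rewrite /=; case: (odd i) => /=.
    apply: (pointed_iso Hc (star_step Kd _)); first by rewrite -eqHK.
    by rewrite card_singleton_coalition_graph.
  apply: (pointed_iso Kd (isolated_clique_step Hc)).
  by rewrite card_singleton_coalition_graph.
split=> //; rewrite (L_SCC_chain chG) /chain_length asboolF //.
by move=> /(_ 1 isT); apply: isolated_clique_star_niso Hc Kd gt1.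
Qed.

(** * From minimum degree zero to the cases by order *)

Lemma min_degree0 (G : sgraph) : 0 < #|G| -> min_degree G = 0 ->
  exists v : G, degree v = 0.
Proof.
move=> G0 /eqP d0; apply: contrapT => h; move: d0; apply/negP; rewrite -lt0n.
(* The default value [#|G|] of the minimum is positive as well. *)
apply: (big_ind (fun k => 0 < k)) => // [x y x0 y0|v _].
  by rewrite leq_min x0.
by rewrite lt0n; apply/eqP => dv; apply: h; exists v.
Qed.

Theorem theorem8 (G : sgraph) (n : nat)
    (hn : graph_order G = n) (hSP : SP_graph G) (hdelta : min_degree G = 0) :
  [/\ (n = 1 ->
        [/\ G ≅ complete 1,
            L_SCC G = Fin 0
          & G_SC_chain G (InfChain (fun _ => complete 1))]),
      (n = 2 ->
        [/\ G ≅ edgeless 2,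
            L_SCC G = Infty
          & G_SC_chain G
              (InfChain (fun i => if odd i then complete 2 else edgeless 2))]),
      (n > 3 ->
        [/\ G ≅ disjoint_union (complete 1) (complete (n - 1)),
            L_SCC G = Fin 1
          & G_SC_chain G (FinChain G [:: complete_bipartite 1 (n - 1)])])
    & (n = 3 ->
        [/\ G ≅ disjoint_union (complete 1) (complete 2),
            L_SCC G = Infty
          & G_SC_chain G
              (InfChain (fun i => if odd i then path_graph 3
                                  else disjoint_union (complete 1) (complete 2)))])].
Proof.
move: hn; rewrite /graph_order => hn.
have clique : 0 < n -> exists v : G, isolated_clique v.
  rewrite -hn => /min_degree0/(_ hdelta)[v dv]; exists v.
  exact: SP_isolated_clique.
have G_iso (H : sgraph) (c : H) : isolated_clique c -> 0 < n -> #|H| = n -> G ≅ H.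
  move=> Hc /clique[v Gv] Hn; by apply: (pointed_iso Gv Hc); rewrite hn.
split=> n_eq.
- have GK1 : G ≅ complete 1.
    by apply: (G_iso _ _ complete1_isolated_clique); rewrite ?n_eq //= card_ord.
  have K1K1 : complete 1 ≅ singleton_coalition_graph (complete 1).
    (* $K_1$ has both shapes, so it is its own singleton coalition graph. *)
    have K1star : @star (complete 1) ord0 by move=> a b; rewrite !ord1.
    apply: (pointed_iso K1star (isolated_clique_step complete1_isolated_clique)).
    by rewrite card_singleton_coalition_graph.
  have chG : G_SC_chain G (InfChain (fun _ => complete 1)).
    apply: G_SC_chain_infinite => // [|_]; first exact: iso_sym.
    exact: isolated_clique_SP complete1_isolated_clique.
  split=> //; rewrite (L_SCC_chain chG) /chain_length asboolT // => i _.
  exact: iso_refl.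
- have GH : G ≅ edgeless 2.
    by apply: (G_iso _ _ edgeless2_isolated_clique); rewrite ?n_eq //= card_ord.
  by case: (alternating_chain edgeless2_isolated_clique complete2_star _ _ GH);
    rewrite /= ?card_ord.
- have n_gt0 : 0 < n by apply: ltn_trans n_eq.
  have [v Gv] := clique n_gt0.
  have cardS : #|complete_bipartite 1 (n - 1)| = n.
    by rewrite /= card_sum !card_ord subnKC.
  have cardU : #|disjoint_union (complete 1) (complete (n - 1))| = n.
    by rewrite /= card_sum !card_ord subnKC.
  have notSP : SP_graph (complete_bipartite 1 (n - 1)) = false.
    by rewrite (star_SP (@complete_bipartite_star _)) cardS leqNgt n_eq.
  have chG : G_SC_chain G (FinChain G [:: complete_bipartite 1 (n - 1)]).
    split; first split=> [|[|//] _ /=]; first exact: iso_refl.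
      split=> //.
      apply: (pointed_iso (@complete_bipartite_star _) (isolated_clique_step Gv)).
      by rewrite card_singleton_coalition_graph cardS.
    (* A chain with at least two steps would have at index 1 an SP-graph isomorphic to
       $K_{1,n-1}$. *)
    move=> c' c'G; apply: contraFT notSP => gt1.
    have le2 : leqe (Fin 2) (steps c').
      by case: (steps c') gt1 => //= k; rewrite -ltnNge.
    have [sp _] := c'G.2 _ le2; apply: iso_SP sp.
    have le1 : leqe (Fin 1) (steps c').
      by case: (steps c') le2 => //= k /ltnW.
    apply: iso_trans (chain_nth_iter c'G le1) _.
    apply: (pointed_iso (isolated_clique_step Gv) (@complete_bipartite_star _)).
    by rewrite card_singleton_coalition_graph cardS.
  split=> //.
    exact: (G_iso _ _ (@disjoint_union_isolated_clique _)).
  (* Index 1 holds a star, not isomorphic to [G], so the length is the number of steps. *)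
  rewrite (L_SCC_chain chG) /chain_length asboolF // => /(_ 1 isT).
  apply: isolated_clique_star_niso Gv (@complete_bipartite_star _) _.
  by rewrite hn (ltn_trans _ n_eq).
- have cardH : #|disjoint_union (complete 1) (complete 2)| = 3.
    by rewrite /= card_sum !card_ord.
  have GH : G ≅ disjoint_union (complete 1) (complete 2).
    by apply: (G_iso _ _ (@disjoint_union_isolated_clique _)); rewrite ?n_eq.
  have cardP : #|path_graph 3| = 3 by rewrite card_ord.
  by case: (alternating_chain (@disjoint_union_isolated_clique 2) path3_star _ _ GH);
    rewrite ?cardH ?cardP.
Qed.
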